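(* For every $i\in\mathbb{N}_0$ there is a quadtree configuration $T$ with $\mathrm{cap}(T)\ge 4^{-i}$, whose smallest assigned square is an $s$-square, such that every insertion of an $i$-square into $T$ has movement cost at least \[ 4^{\min\{s-i,\, i\}}-1. \] Moreover, this lower bound is in $\Omega(2^{h(T)})$: there is an absolute constant $c>0$ such that for every $i\ge 1$ the configuration $T$ can be chosen so that this lower bound is at least $c\cdot 2^{h(T)}$.
   Context: The unit square $[0,1]^2$ is recursively subdivided as a quadtree of unbounded depth: the root (layer $0$) is $[0,1]^2$, and every node (pixel) of layer $j$ is an axis-parallel square of side $2^{-j}$ whose four children are its four quadrants. A pixel of layer $j$ is a $j$-pixel. For $r\in\mathbb{N}_0$, an $r$-square is an axis-parallel square of side $2^{-r}$. A (quadtree) configuration $T$ assigns finitely many squares to pixels, each $j$-square to a $j$-pixel, at most one square per pixel, such that no pixel with an assigned square is a proper descendant of another pixel with an assigned square. A pixel $p$ contains a square if it is assigned to $p$ or to a descendant of $p$. A pixel with an assigned square is occupied. A non-occupied pixel is blocked if some ancestor is occupied, free otherwise; a free pixel is empty if it contains no square. The capacity $\mathrm{cap}(p)$ of a $j$-pixel $p$ is $0$ if $p$ is occupied or blocked, $4^{-j}$ if $p$ is empty, and otherwise the sum of the capacities of its four children; $\mathrm{cap}(T)$ is the capacity of the root. The height $h(T)$ is $0$ if the root is empty and otherwise the maximum of $r+1$ over all $r$ such that $T$ contains an $r$-square. A move takes a $j$-square assigned to a $j$-pixel $p$ and reassigns it to a $j$-pixel $q$ that is empty before the move; moves are performed one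 at a time. Inserting an $i$-square $Q$ into $T$ means performing a sequence of moves producing a configuration with an empty $i$-pixel and then assigning $Q$ to it. If $\{s_1,\dots,s_k\}$ is the set of squares moved during the insertion, its movement cost is $k$.
   Formalization: For i = 0 the condition cap(T) ≥ 1 forces T to contain no squares, so a smallest assigned square cannot exist; its existence is therefore claimed only for i ≥ 1, and for i = 0 the cost bound is claimed only for an s for which a smallest square exists. *)

(* Defs.v *)
From HB Require Import structures.
From mathcomp Require Import all_boot all_order all_algebra.

Set Implicit Arguments.
Unset Strict Implicit.
Unset Printing Implicit Defensive.

Import Order.TTheory GRing.Theory Num.Theory.
Local Open Scope ring_scope.

(* A quadrant is (right half?, upper half?).  A pixel is the path of quadrants
   leading to it from the root [::], the unit square; the path of length j
   whose k-th step is (a_k, b_k) is the square of side 2^-j with lower left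
   corner (\sum_k a_k 2^-k, \sum_k b_k 2^-k), k = 1 .. j. *)
Definition quadrant := (bool * bool)%type.
Definition pixel := seq quadrant.

Definition layer (p : pixel) : nat := size p.

Definition child (p : pixel) (c : quadrant) : pixel := rcons p c.

Definition proper_descendant (p q : pixel) : bool := prefix p q && (p != q).

(* Squares are labelled by S, so that a square keeps its identity when it is
   moved; lay x = r means that x is an r-square. *)
Record config (S : finType) (lay : S -> nat) := Config {
  pos :> S -> pixel;
  layer_pos : forall x, layer (pos x) = lay x;
  pos_inj : injective pos;
  pos_antichain : forall x y, ~~ proper_descendant (pos x) (pos y)
}.

Definition contains (S : finType) (lay : S -> nat) (T : config lay)
  (p : pixel) (x : S) : bool := (T x == p) || proper_descendant p (T x).

Definition occupied (S : finType) (lay : S -> nat) (T : config lay)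
  (p : pixel) : bool := [exists x, T x == p].

Definition blocked (S : finType) (lay : S -> nat) (T : config lay)
  (p : pixel) : bool :=
  ~~ occupied T p && [exists x, proper_descendant (T x) p].

Definition free (S : finType) (lay : S -> nat) (T : config lay)
  (p : pixel) : bool := ~~ occupied T p && ~~ blocked T p.

Definition empty (S : finType) (lay : S -> nat) (T : config lay)
  (p : pixel) : bool := free T p && [forall x, ~~ contains T p x].

Definition height (S : finType) (lay : S -> nat) (T : config lay) : nat :=
  if empty T [::] then 0%N else (\max_(x : S) (lay x).+1)%N.

Fixpoint cap_rec (S : finType) (lay : S -> nat) (T : config lay)
  (n : nat) (p : pixel) : rat :=
  if occupied T p || blocked T p then 0
  else if empty T p then 4 ^- layer p
  else if n is n'.+1 then \sum_(c : quadrant) cap_rec T n' (child p c)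
  else 0.

(* The fuel height T is enough: see pixel_capE for the recursive equation. *)
Definition pixel_cap (S : finType) (lay : S -> nat) (T : config lay)
  (p : pixel) : rat := cap_rec T (height T) p.

Definition cap (S : finType) (lay : S -> nat) (T : config lay) : rat :=
  pixel_cap T [::].

Definition move (S : finType) (lay : S -> nat) (T : config lay)
  (x : S) (q : pixel) (T' : config lay) : Prop :=
  [/\ layer q = lay x, empty T q, T' x = q & forall y, y != x -> T' y = T y].

(* moves T xs T': the squares xs, in this order and possibly with repetitions,
   are moved one at a time, leading from T to T'. *)
Inductive moves (S : finType) (lay : S -> nat) :
  config lay -> seq S -> config lay -> Prop :=
| moves_nil T : moves T [::] T
| moves_cons T x q T' xs T'' :
    move T x q T' -> moves T' xs T'' -> moves T (x :: xs) T''.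

(* The squares after the insertion of an i-square are those of S and the
   inserted one, None. *)
Definition insert_lay (S : finType) (lay : S -> nat) (i : nat) :
  option S -> nat := fun o => if o is Some x then lay x else i.

Definition insertion (S : finType) (lay : S -> nat) (i : nat)
  (T : config lay) (xs : seq S) (U : config (insert_lay lay i)) : Prop :=
  exists (T' : config lay) (p : pixel),
    [/\ moves T xs T', layer p = i, empty T' p, U None = p
      & forall x, U (Some x) = T' x].

Definition movement_cost (S : finType) (xs : seq S) : nat :=
  #|[set x in xs]|.

(* The smallest square is the one of the largest index. *)
Definition smallest_square (S : finType) (lay : S -> nat) (T : config lay)
  (s : nat) : Prop :=
  (exists x : S, lay x = s) /\ (forall x : S, (lay x <= s)%N).

(* The difference s - i is taken in int and may be negative. *)
Definition cost_bound (s i : nat) : rat :=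
  (4 : rat) ^ (Num.min (s%:Z - i%:Z) i%:Z) - 1.

Definition insertions_cost_at_least (S : finType) (lay : S -> nat) (i : nat)
  (T : config lay) (b : rat) : Prop :=
  forall (xs : seq S) (U : config (insert_lay lay i)),
    insertion T xs U -> b <= (movement_cost xs)%:R.

Lemma cap_rec_stable (S : finType) (lay : S -> nat) (T : config lay)
  (n : nat) (p : pixel) :
  (height T <= n + layer p)%N -> cap_rec T n p = cap_rec T n.+1 p.
Proof.
elim: n p => [|n IHn] p hn.
  rewrite /=; case: ifP => // Hf; case: ifP => // He; exfalso.
  move: He; rewrite /empty /free -negb_or Hf /= => /negbT.
  rewrite negb_forall => /existsP[x]; rewrite negbK => Hc.
  have Hocc : T x != p.
    apply/negP => Hx; move: Hf => /negbT; rewrite negb_or => /andP[/negP + _].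
    by apply; apply/existsP; exists x.
  move: Hc; rewrite /contains (negbTE Hocc) /= => /andP[Hpre Hne].
  have hlt : (size p < size (T x))%N.
    case/prefixP: Hpre Hne => -[|a t] ->; first by rewrite cats0 eqxx.
    by rewrite size_cat /= addnS ltnS leq_addr.
  have Hroot : empty T [::] = false.
    apply/negP => /andP[_ /forallP/(_ x)]; rewrite /contains negb_or.
    rewrite /proper_descendant prefix0s /= negbK => /andP[_ /eqP E].
    by move: hlt; rewrite -E.
  move: hn; rewrite /height Hroot add0n /layer leqNgt => /negP; apply.
  apply: leq_trans (leq_bigmax x).
  by rewrite -(layer_pos T x) /layer ltnS ltnW.
rewrite [LHS]/= [RHS]/=; case: ifP => // _; case: ifP => // _.
apply: eq_bigr => c _; apply: IHn.
by rewrite /layer size_rcons addnS -addSn.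
Qed.

Lemma pixel_capE (S : finType) (lay : S -> nat) (T : config lay) (p : pixel) :
  pixel_cap T p =
  if occupied T p || blocked T p then 0
  else if empty T p then 4 ^- layer p
  else \sum_(c : quadrant) pixel_cap T (child p c).
Proof. by rewrite /pixel_cap cap_rec_stable ?leq_addr. Qed.

Lemma emptyP (S : finType) (lay : S -> nat) (T : config lay) (p : pixel) :
  reflect (forall x, ~~ prefix p (T x) /\ ~~ prefix (T x) p) (empty T p).
Proof.
apply: (iffP idP) => [/andP[/andP[Ho Hb] /forallP Hc] x | H].
  have Hx : T x != p by apply: contra Ho => Hx; apply/existsP; exists x.
  split.
    have := Hc x; rewrite /contains (negbTE Hx) /= /proper_descendant.
    by rewrite eq_sym Hx andbT.
  apply: contra Hb => Hp; rewrite /blocked Ho /=.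
  by apply/existsP; exists x; rewrite /proper_descendant Hp.
have Ho : ~~ occupied T p.
  apply/existsP => -[x /eqP E].
  by case: (H x) => + _; rewrite E prefix_refl.
rewrite /empty /free Ho /blocked /= Ho /=; apply/andP; split.
  by apply/existsP => -[x /andP[Hx _]]; case: (H x) => _; rewrite Hx.
apply/forallP => x; rewrite /contains; apply/negP => /orP[/eqP E|/andP[Hp _]].
  by case: (H x) => + _; rewrite E prefix_refl.
by case: (H x); rewrite Hp.
Qed.

Lemma move_exists (S : finType) (lay : S -> nat) (T : config lay)
  (x : S) (q : pixel) :
  layer q = lay x -> empty T q -> exists T' : config lay, move T x q T'.
Proof.
move=> Hq He; have /emptyP H := He.
pose f y := if y == x then q else T y.
have f_lay y : layer (f y) = lay y.
  by rewrite /f; case: eqP => [->|_] //; exact: layer_pos.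
have f_inj : injective f.
  move=> y z; rewrite /f; case: eqP => [->|_]; case: eqP => [->|_] // E.
  - by case: (H z); rewrite -E prefix_refl.
  - by case: (H y); rewrite E prefix_refl.
  - exact: pos_inj E.
have f_anti y z : ~~ proper_descendant (f y) (f z).
  rewrite /f; case: eqP => _; case: eqP => _.
  - by rewrite /proper_descendant eqxx andbF.
  - by rewrite /proper_descendant negb_and; case: (H z) => ->.
  - by rewrite /proper_descendant negb_and; case: (H y) => _ ->.
  - exact: pos_antichain.
exists (Config f_lay f_inj f_anti); split=> //=; first by rewrite /f eqxx.
by move=> y /negbTE Hy; rewrite /f Hy.
Qed.

Lemma insertion_exists (S : finType) (lay : S -> nat) (T T' : config lay)
  (xs : seq S) (p : pixel) :
  moves T xs T' -> empty T' p ->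
  exists U : config (insert_lay lay (layer p)), insertion T xs U.
Proof.
move=> Hm He; have /emptyP H := He.
pose f o := if o is Some y then T' y else p.
have f_lay o : layer (f o) = insert_lay lay (layer p) o.
  by case: o => [y|] //=; exact: layer_pos.
have f_inj : injective f.
  move=> [y|] [z|] //= E.
  - by rewrite (pos_inj E).
  - by case: (H y); rewrite E prefix_refl.
  - by case: (H z); rewrite -E prefix_refl.
have f_anti o o' : ~~ proper_descendant (f o) (f o').
  rewrite /proper_descendant negb_and; case: o o' => [y|] [z|] /=.
  - by rewrite -negb_and; exact: pos_antichain.
  - by case: (H y) => _ ->.
  - by case: (H z) => ->.
  - by rewrite eqxx orbT.
by exists (Config f_lay f_inj f_anti), T', p.
Qed.

(* Main.v *)
(** Leave exactly one [i + i]-pixel free in each of the [4 ^ i] [i]-pixels and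
    put [i + i]-squares on all the others.  The free pixels add up to the
    capacity [4 ^- i]; but an [i]-pixel that is empty after some moves has lost
    all of its [4 ^ i - 1] original squares, and each of them was moved. *)

Require Import Defs.
From HB Require Import structures.
From mathcomp Require Import all_boot all_order all_algebra.
From mathcomp Require Import lra.

Set Implicit Arguments.
Unset Strict Implicit.
Unset Printing Implicit Defensive.

Import Order.TTheory GRing.Theory Num.Theory.
Local Open Scope ring_scope.

Lemma card_tuple_quadrant (n : nat) : #|{: n.-tuple quadrant}| = (4 ^ n)%N.
Proof. by rewrite card_tuple card_prod card_bool. Qed.

(** All squares and holes below lie in one layer, so each question about ancestors reduces to an
    equality of paths. *)
Lemma prefix_eq_size (A : eqType) (s t : seq A) :
  size s = size t -> prefix s t = (s == t).
Proof. by move=> E; rewrite prefixE E take_size eq_sym. Qed.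

Section Configurations.
Variables (S : finType) (lay : S -> nat).
Implicit Types (T : config lay) (p : pixel).

Lemma cap_rec_ge0 T n p : 0 <= cap_rec T n p.
Proof.
elim: n p => [|n IHn] p /=; case: ifP => // _; case: ifP => // _.
- by rewrite invr_ge0 exprn_ge0.
- by rewrite invr_ge0 exprn_ge0.
- exact: sumr_ge0.
Qed.

(** Each empty pixel found [m] layers below [p] contributes its whole area to the capacity of [p].
    The induction on [m] follows the recursive equation [pixel_capE]. *)
Lemma pixel_cap_ge_empty T m p :
  (\sum_(t : m.-tuple quadrant) empty T (p ++ t))%N%:R * 4 ^- (layer p + m)
    <= pixel_cap T p.
Proof.
elim: m p => [|m IHm] p.
  rewrite (big_pred1 [tuple]) => [|t]; last by rewrite [t]tuple0 [RHS]eqxx.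
  rewrite cats0 addn0 pixel_capE.
  case: (boolP (empty T p)) => [He|_].
    have /andP[/andP[/negbTE -> /negbTE ->] _] := He.
    by rewrite /= mul1r.
  rewrite mul0r; case: ifP => // _.
  by apply: sumr_ge0 => c _; apply: cap_rec_ge0.
rewrite pixel_capE; case: ifP => [Hp|_].
  (* A square assigned to [p] or to an ancestor lies above every descendant of [p], so none of them
     is empty and the count vanishes. *)
  rewrite big1 ?mul0r // => t _; apply/eqP; rewrite eqb0.
  apply/emptyP => H.
  have [x] : exists x, prefix (T x) p.
    case/orP: Hp => [/existsP[x /eqP <-]|/andP[_ /existsP[x /andP[Hx _]]]];
      by exists x; rewrite ?prefix_refl.
  move=> Hx; have [_ /negP[]] := H x.
  by apply: prefix_trans Hx _; apply: prefix_prefix.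
case: ifP => [_|_].
  (* Here [p] is empty, and the count is at most [4 ^ m], the number of all descendants at that
     depth. *)
  rewrite exprD invfM mulrCA ler_piMr ?invr_ge0 ?exprn_ge0 //.
  rewrite ler_pdivrMr ?exprn_gt0 // mul1r -natrX ler_nat.
  rewrite -card_tuple_quadrant -sum1_card; apply: leq_sum => t _.
  exact: leq_b1.
(* Splitting off the first quadrant of a path groups the descendants by the child of [p] that
   contains them. *)
pose f (u : quadrant * m.-tuple quadrant) := [tuple of u.1 :: u.2].
have f_bij : bijective f.
  exists (fun t => (thead t, [tuple of behead t])) => [[c t]|t].
    by congr pair; apply: val_inj.
  by rewrite /f /= [RHS]tuple_eta.
rewrite (reindex f) /=; last exact: onW_bij.
rewrite -(pair_bigA _ (fun c t => nat_of_bool (empty T (p ++ c :: val t)))) /=.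
rewrite natr_sum mulr_suml; apply: ler_sum => c _.
have := IHm (child p c); rewrite /layer /child size_rcons addSnnS.
by congr (_%:R * _ <= _); apply: eq_bigr => t _; rewrite cat_rcons.
Qed.

Lemma cap_ge_empty T m :
  #|[set t : m.-tuple quadrant | empty T t]|%:R * 4 ^- m <= cap T.
Proof.
have := pixel_cap_ge_empty T m [::]; rewrite add0n.
congr (_%:R * _ <= _); rewrite -sum1_card [RHS]big_mkcond /=.
by apply: eq_bigr => t _; rewrite inE; case: (empty T t).
Qed.

Lemma moves_notin T xs T' x : moves T xs T' -> x \notin xs -> T' x = T x.
Proof.
elim=> // {}T y q {}T' ys T'' [_ _ _ fixT] _ IH.
by rewrite inE negb_or => /andP[xy xys]; rewrite IH // fixT.
Qed.

(** A square that is never moved keeps its pixel, so if it started inside [p], it would still be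
    there and [p] would not be empty. *)
Lemma movement_cost_ge_contained T xs T' p :
  moves T xs T' -> empty T' p ->
  (#|[set x | prefix p (T x)]| <= movement_cost xs)%N.
Proof.
move=> mT /emptyP He; apply/subset_leq_card/subsetP => x; rewrite !inE => px.
by apply: contraLR px => xs'; rewrite -(moves_notin mT xs'); case: (He x).
Qed.

End Configurations.

Section SpreadHoles.
Variable i : nat.

Definition corner : i.-tuple quadrant := [tuple of nseq i (false, false)].

(** The label of a square is the path of its initial pixel; the last [i] quadrants of the path
    locate it within its [i]-pixel. *)
Definition non_hole :=
  {t : (i + i).-tuple quadrant | drop i t != corner}.

Definition non_hole_layer (x : non_hole) : nat := (i + i)%N.

Definition non_hole_pixel (x : non_hole) : pixel := val (val x).

Lemma non_hole_pixel_layer x : layer (non_hole_pixel x) = non_hole_layer x.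
Proof. exact: size_tuple. Qed.

Lemma non_hole_pixel_inj : injective non_hole_pixel.
Proof. by move=> x y /val_inj/val_inj. Qed.

Lemma non_hole_pixel_antichain x y :
  ~~ proper_descendant (non_hole_pixel x) (non_hole_pixel y).
Proof.
by rewrite /proper_descendant prefix_eq_size ?andbN // !size_tuple.
Qed.

Definition spread_holes : config non_hole_layer :=
  Config non_hole_pixel_layer non_hole_pixel_inj non_hole_pixel_antichain.

Lemma hole_empty (u : i.-tuple quadrant) :
  empty spread_holes (u ++ corner).
Proof.
apply/emptyP => x; rewrite !prefix_eq_size ?size_cat ?size_tuple //.
rewrite [in X in _ /\ X]eq_sym; suff: u ++ corner != spread_holes x by [].
apply: contra (valP x) => /eqP E.
by rewrite -[val (val x)]E drop_size_cat ?size_tuple.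
Qed.

Lemma cap_spread_holes : 4 ^- i <= cap spread_holes.
Proof.
apply: le_trans (cap_ge_empty spread_holes (i + i)).
rewrite exprD invfM mulrA ler_peMl ?invr_ge0 ?exprn_ge0 //.
rewrite ler_pdivlMr ?exprn_gt0 // mul1r -natrX ler_nat -card_tuple_quadrant.
(* One hole for each [i]-pixel [u]: [4 ^ i] holes of area [4 ^- (i + i)] each. *)
pose f (u : i.-tuple quadrant) := [tuple of u ++ corner].
have f_inj : injective f.
  move=> u v /(congr1 (take i \o val)) /=.
  by rewrite !take_size_cat ?size_tuple // => /val_inj.
rewrite -cardsT -(card_imset _ f_inj).
by apply/subset_leq_card/subsetP => _ /imsetP[u _ ->]; rewrite inE hole_empty.
Qed.

(** The relative paths of length [i] other than [corner] inject into the squares below [p]. *)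
Lemma card_spread_holes_in p :
  layer p = i ->
  ((4 ^ i).-1 <= #|[set x | prefix p (spread_holes x)]|)%N.
Proof.
move=> p_i; pose q : i.-tuple quadrant := Tuple (introT eqP p_i).
rewrite -card_tuple_quadrant -(cardC1 corner) -(card_imset _ val_inj).
pose f (u : i.-tuple quadrant) := [tuple of q ++ u].
have f_inj : injective f.
  move=> u v /(congr1 (drop i \o val)) /=.
  by rewrite !drop_size_cat ?p_i // => /val_inj.
rewrite -(card_imset _ f_inj).
apply/subset_leq_card/subsetP => _ /imsetP[u u_corner ->].
have fu : drop i (f u) != corner by rewrite /= drop_size_cat ?p_i.
apply/imsetP; exists (exist _ (f u) fu) => //.
by rewrite inE; apply: prefix_prefix.
Qed.

Lemma smallest_square_spread_holes s :
  smallest_square spread_holes s -> s = (i + i)%N.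
Proof. by case=> -[x <-]. Qed.

(** For [i = 0] the root itself is the hole and there are no squares at all. *)
Lemma non_hole_inhabited : (0 < i)%N -> inhabited non_hole.
Proof.
move=> i0; pose t := [tuple of nseq (i + i) (true, true)].
have tP : drop i t != corner by rewrite /= drop_nseq addnK; case: (i) i0.
by split; exists t.
Qed.

Lemma smallest_square_spread_holes_exists :
  (0 < i)%N -> smallest_square spread_holes (i + i).
Proof. by move=> /non_hole_inhabited[x]; split=> //; exists x. Qed.

Lemma height_spread_holes :
  (0 < i)%N -> height spread_holes = (i + i).+1.
Proof.
move=> /non_hole_inhabited[x]; rewrite /height.
case: emptyP => [/(_ x)[]|_]; first by rewrite prefix0s.
apply/eqP; rewrite eqn_leq; apply/andP; split; first exact/bigmax_leqP.
exact: (leq_bigmax x).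
Qed.

Lemma cost_bound_double : cost_bound (i + i) i = (4 ^ i).-1%:R.
Proof.
rewrite /cost_bound PoszD addrK minxx -exprnP -subn1 natrB ?expn_gt0 //.
by rewrite natrX.
Qed.

Lemma spread_holes_insertion :
  insertions_cost_at_least i spread_holes (cost_bound (i + i) i).
Proof.
move=> xs U [T' [p [mT p_i He _ _]]]; rewrite cost_bound_double ler_nat.
apply: leq_trans (card_spread_holes_in p_i) _.
exact: movement_cost_ge_contained mT He.
Qed.

(** With [x = 4 ^ i], the claim reads [3 / 4 * x <= x - 1], that is [4 <= x]; equality at [i = 1]
    determines the constant [3 / 8]. *)
Lemma height_cost_bound :
  (0 < i)%N -> 3 / 8 * 2 ^+ height spread_holes <= cost_bound (i + i) i.
Proof.
move=> i0; rewrite height_spread_holes // cost_bound_double addnn -mul2n.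
rewrite exprS exprM -subn1 natrB ?expn_gt0 // natrX -[2 ^+ 2]/(4 : rat).
have : 4 <= 4 ^+ i :> rat by rewrite -{1}[4]expr1 ler_weXn2l.
lra.
Qed.

End SpreadHoles.

Theorem theorem5 :
  (forall i : nat, exists (S : finType) (lay : S -> nat) (T : config lay),
     [/\ 4 ^- i <= cap T,
         (0 < i)%N -> exists s : nat, smallest_square T s
       & forall s : nat, smallest_square T s ->
           insertions_cost_at_least i T (cost_bound s i)]) /\
  (exists2 c : rat, 0 < c &
     forall i : nat, (0 < i)%N ->
       exists (S : finType) (lay : S -> nat) (T : config lay) (s : nat),
         [/\ 4 ^- i <= cap T,
             smallest_square T s,
             insertions_cost_at_least i T (cost_bound s i)
           & c * 2 ^+ height T <= cost_bound s i]).
Proof.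
split=> [i|].
  exists (non_hole i), (@non_hole_layer i), (spread_holes i); split.
  - exact: cap_spread_holes.
  - by exists (i + i)%N; apply: smallest_square_spread_holes_exists.
  - move=> s /smallest_square_spread_holes ->; exact: spread_holes_insertion.
exists (3 / 8) => // i i0.
exists (non_hole i), (@non_hole_layer i), (spread_holes i), (i + i)%N; split.
- exact: cap_spread_holes.
- exact: smallest_square_spread_holes_exists.
- exact: spread_holes_insertion.
- exact: height_cost_bound.
Qed.
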